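(* $f_{\triangle}(1,1)=1$, and $f_{\triangle}(d,d)=d^2+1$ for every integer $d\ge 2$.
   Context: All graphs are finite, simple and undirected. A graph is triangle-free if it has no three pairwise adjacent vertices. $\Delta(G)$ is the maximum degree and $\nu(G)$ the matching number of $G$. For positive integers $d,m$, $f_{\triangle}(d,m)$ is the maximum number of edges of a triangle-free graph $G$ with $\Delta(G)\le d$ and $\nu(G)\le m$. *)

(* Defs.v *)
From mathcomp Require Import all_boot.
Set Implicit Arguments.
Unset Strict Implicit.
Unset Printing Implicit Defensive.

Record sgraph := SGraph {
  vertex : finType;
  adj : rel vertex;
  adj_sym : symmetric adj;
  adj_irr : irreflexive adj
}.

Definition edges (G : sgraph) : {set {set vertex G}} :=
  [set e | [exists x, exists y, adj x y && (e == [set x; y])]].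

Definition degree (G : sgraph) (x : vertex G) : nat := #|[set y | adj x y]|.

Definition max_degree (G : sgraph) : nat := \max_(x : vertex G) degree x.

Definition is_matching (G : sgraph) (M : {set {set vertex G}}) : bool :=
  (M \subset edges G) && trivIset M.

Definition matching_number (G : sgraph) : nat :=
  \max_(M : {set {set vertex G}} | is_matching M) #|M|.

Definition triangle_free (G : sgraph) : Prop :=
  forall x y z : vertex G, ~ [/\ adj x y, adj y z & adj x z].

Definition admissible (d m : nat) (G : sgraph) : Prop :=
  [/\ triangle_free G, max_degree G <= d & matching_number G <= m].

(* "f_triangle(d, m) = k": the maximum exists and equals k.  The graphs range
   over all finite vertex types, so f_triangle is given by its graph rather
   than computed as a finite \max. *)
Definition f_triangle_eq (d m k : nat) : Prop :=
  (exists2 G : sgraph, admissible d m G & #|edges G| = k) /\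
  (forall G : sgraph, admissible d m G -> #|edges G| <= k).

(* Main.v *)
(* Let G be triangle-free with maximum degree and matching number at most d.
   If some vertex is covered by every maximum matching, delete it: this costs at
   most d edges and lowers the matching number.  Otherwise, by Gallai's lemma,
   "no maximum matching misses both x and y" (or x = y) is an equivalence
   relation containing adjacency, and a maximum matching misses at most one
   vertex of each class.  A class with 2k + 1 vertices, k < d, has at most
   k (k + 1) <= d k edges by Mantel's theorem; a class with 2d + 1 vertices has
   at most d^2 + 1 edges, and there is at most one of those.  Equality is
   attained by subdividing one edge of the complete bipartite graph K_{d,d}. *)

Require Import Defs.
From mathcomp Require Import all_boot zify.
Set Implicit Arguments.
Unset Strict Implicit.
Unset Printing Implicit Defensive.

(** * Degree sums inside a vertex set; each edge counts twice *)

Section LocalCounting.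

Variables (T : finType) (e : rel T).
Hypotheses (e_sym : symmetric e) (e_irr : irreflexive e).
Hypothesis e_trifree : forall x y z, e x y -> e y z -> e x z -> False.

Definition deg_in (Y : {set T}) (x : T) : nat := \sum_(y in Y) e x y.

Lemma deg_in_card Y x : deg_in Y x = #|[set y in Y | e x y]|.
Proof.
by rewrite -sum1dep_card big_mkcondr; apply: eq_bigr => y _; case: (e x y).
Qed.

Lemma deg_in_setD (B C : {set T}) x :
  B \subset C -> deg_in C x = deg_in (C :\: B) x + deg_in B x.
Proof.
by move=> sBC; rewrite /deg_in (big_setID B) /= (setIidPr sBC) addnC.
Qed.

Lemma exchange_deg_in (X Y : {set T}) :
  \sum_(x in X) deg_in Y x = \sum_(y in Y) deg_in X y.
Proof.
rewrite exchange_big; apply: eq_bigr => y _; apply: eq_bigr => x _.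
by rewrite e_sym.
Qed.

(** A vertex [z] counted in both degrees would close a triangle with [x] and [y]. *)
Lemma deg_in_adjacent (B : {set T}) x y :
  e x y -> deg_in B x + deg_in B y <= #|B|.
Proof.
move=> exy; rewrite -big_split /= -sum1_card; apply: leq_sum => z _.
case exz: (e x z); case eyz: (e y z) => //.
by case: (e_trifree exy eyz exz).
Qed.

(* Each edge of a triangle-free graph has an endpoint in the complement of a
   neighbourhood, and two such endpoints if it lies inside that complement. *)
Lemma sum_deg_in_nbhd_compl (B C : {set T}) v :
  B = [set y in C | e v y] ->
  \sum_(x in C) deg_in C x + \sum_(x in C :\: B) deg_in (C :\: B) x =
  2 * \sum_(x in C :\: B) deg_in C x.
Proof.
move=> defB.
have sBC : B \subset C by apply/subsetP => y; rewrite defB inE => /andP[].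
have BB0 : \sum_(x in B) deg_in B x = 0.
  apply: big1 => x; rewrite defB inE => /andP[_ evx]; apply: big1 => y.
  rewrite inE => /andP[_ evy]; case exy: (e x y) => //.
  by case: (e_trifree evx exy evy).
rewrite (big_setID B) /= (setIidPr sBC).
have -> : \sum_(x in B) deg_in C x = \sum_(x in C :\: B) deg_in B x.
  under eq_bigr => x _ do rewrite (deg_in_setD x sBC).
  by rewrite big_split /= BB0 addn0 exchange_deg_in.
have -> : \sum_(x in C :\: B) deg_in C x =
    \sum_(x in C :\: B) deg_in (C :\: B) x + \sum_(x in C :\: B) deg_in B x.
  by rewrite -big_split; apply: eq_bigr => x _; exact: deg_in_setD.
lia.
Qed.

(** Take [s] to be the largest degree inside [C]: every edge has an end among the [#|C| - s]
    vertices outside the neighbourhood of a vertex attaining it. Keeping [s] explicit lets the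
    parity of [#|C|] be exploited later. *)
Lemma mantel_bound (C : {set T}) :
  exists2 s, s <= #|C| & \sum_(x in C) deg_in C x <= 2 * (s * (#|C| - s)).
Proof.
have [->|[v0 v0C]] := set_0Vmem C; first by exists 0; rewrite ?big_set0.
case: (arg_maxnP (deg_in C) v0C) => v vC vmax.
pose B := [set y in C | e v y].
have sBC : B \subset C by apply/subsetP => y; rewrite inE => /andP[].
have cB : #|B| = deg_in C v by rewrite deg_in_card.
exists #|B|; first exact: subset_leq_card.
have := sum_deg_in_nbhd_compl (erefl B).
suff : \sum_(x in C :\: B) deg_in C x <= #|B| * (#|C| - #|B|) by lia.
rewrite -cardsDS // mulnC -sum_nat_const; apply: leq_sum => x.
by rewrite inE cB => /andP[_ /vmax].
Qed.

(** Exactly [deg_in A x + deg_in A y - 1] edges meet [x] or [y], since [xy] is seen from both ends;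
    the degree sum counts each of them twice. *)
Lemma sum_deg_in_ge_adjacent (A : {set T}) x y : x \in A -> y \in A -> e x y ->
  2 * (deg_in A x + deg_in A y) <= \sum_(z in A) deg_in A z + 2.
Proof.
move=> xA yA exy; have nxy : y != x by apply: contraTneq exy => ->; rewrite e_irr.
rewrite (bigD1 x) //= (bigD1 y) /=; last by rewrite yA.
have : deg_in A x + deg_in A y <=
    \sum_(z in A | (z != x) && (z != y)) deg_in A z + 2.
  have dE u : deg_in A u = \sum_(z in A) e z u.
    by apply: eq_bigr => z _; rewrite e_sym.
  rewrite !dE -big_split /= (bigD1 x) //= (bigD1 y) /=; last by rewrite yA.
  rewrite !e_irr exy e_sym exy.
  have : \sum_(z in A | (z != x) && (z != y)) (e z x + e z y) <=
         \sum_(z in A | (z != x) && (z != y)) deg_in A z.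
    apply: leq_sum => z _; rewrite /deg_in (bigD1 x) //= (bigD1 y) /=; last by rewrite yA.
    lia.
  under eq_bigl => z do rewrite andbA.
  lia.
under eq_bigl => z do rewrite andbA.
lia.
Qed.

(* Let [v] have degree [d] and [A] be the complement of its neighbourhood.  An
   edge [xy] inside [A] costs as many degrees on its ends as it gains, since
   [x] and [y] have disjoint neighbourhoods among the [d] neighbours of [v]. *)
Lemma sum_deg_in_odd (d : nat) (C : {set T}) : 0 < d ->
  #|C| = d.*2.+1 -> {in C, forall x, deg_in C x <= d} ->
  \sum_(x in C) deg_in C x <= 2 * d ^ 2 + 2.
Proof.
move=> d_gt0 cC ledeg.
have [/existsP[v /andP[vC /eqP dv]]|nov] :=
    boolP [exists v, (v \in C) && (deg_in C v == d)]; last first.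
  (* All degrees are at most [d - 1] here, and [(2d + 1)(d - 1) < 2d^2]. *)
  have : \sum_(x in C) deg_in C x <= #|C| * d.-1.
    rewrite -sum_nat_const; apply: leq_sum => x xC.
    have := ledeg x xC; rewrite leq_eqVlt => /orP[/eqP dx|]; last by lia.
    by case/existsP: nov; exists x; rewrite xC dx eqxx.
  rewrite cC; case: (d) d_gt0 => // k _; nia.
pose B := [set y in C | e v y]; pose A := C :\: B.
have sBC : B \subset C by apply/subsetP => y; rewrite inE => /andP[].
have cB : #|B| = d by rewrite -dv deg_in_card.
have cA : #|A| = d.+1 by rewrite cardsDS // cC cB; lia.
have sAC : {subset A <= C} by move=> x; rewrite inE => /andP[].
have := sum_deg_in_nbhd_compl (erefl B); rewrite -/A => splitE.
have [/existsP[x /existsP[y /and3P[xA yA exy]]]|noe] :=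
    boolP [exists x, exists y, [&& x \in A, y \in A & e x y]].
  have nxy : y != x by apply: contraTneq exy => ->; rewrite e_irr.
  have := sum_deg_in_ge_adjacent xA yA exy.
  have := deg_in_adjacent B exy; rewrite cB.
  have := deg_in_setD x sBC; have := deg_in_setD y sBC; rewrite -/A.
  (* The other [d - 1] vertices of [A] contribute at most [d] each. The ends [x] and [y] send at
     most [d] edges to [B] in total, and the degree sum of [A] in [splitE] offsets their degrees
     inside [A] up to 2. *)
  have : \sum_(z in A) deg_in C z <= deg_in C x + deg_in C y + d * d.-1.
    rewrite (bigD1 x) //= (bigD1 y) /=; last by rewrite yA.
    rewrite addnA leq_add2l.
    have cA' : #|A :\ x :\ y| = d.-1.
      have := cardsD1 x A; have := cardsD1 y (A :\ x).
      by rewrite in_setD1 nxy xA yA cA; lia.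
    rewrite -cA' mulnC -sum_nat_const.
    rewrite [leqRHS](eq_bigl (fun z => [&& z \in A, z != x & z != y])).
      under eq_bigl => z do rewrite -andbA.
      by apply: leq_sum => z /andP[/sAC zC _]; apply: ledeg.
    by move=> z; rewrite !in_setD1 andbC -andbA andbCA.
  have -> : d ^ 2 = d + d * d.-1 by rewrite -mulnS prednK.
  move: splitE; lia.
(* With [A] independent, every edge has exactly one end in [A] and the other in [B], whose [d]
   vertices have degree at most [d]: at most [d^2] edges. *)
have A0 : \sum_(x in A) deg_in A x = 0.
  apply: big1 => x xA; apply: big1 => y yA; case exy: (e x y) => //.
  by case/existsP: noe; exists x; apply/existsP; exists y; rewrite xA yA.
have AB : \sum_(x in A) deg_in C x = \sum_(x in B) deg_in A x.
  rewrite [RHS]exchange_deg_in; under eq_bigr => x _ do rewrite (deg_in_setD x sBC).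
  by rewrite big_split /= -/A A0.
have : \sum_(x in B) deg_in A x <= d * d.
  rewrite -{1}cB -sum_nat_const; apply: leq_sum => x xB.
  have xC : x \in C by exact: (subsetP sBC).
  have := ledeg x xC; rewrite (deg_in_setD x sBC) -/A; lia.
nia.
Qed.

End LocalCounting.

(** * Matchings as involutions, and Gallai's lemma *)

Section InvolutiveMatchings.

Variables (T : finType) (e : rel T).

(* A matching is encoded by the involution exchanging the ends of each of its
   edges, so that the unmatched vertices are the fixed points. *)
Definition matching_fun (f : {ffun T -> T}) : bool :=
  [forall x, (f (f x) == x) && ((f x != x) ==> e x (f x))].

Definition covered (f : {ffun T -> T}) : {set T} := [set x | f x != x].

Definition max_covered : nat := \max_(f | matching_fun f) #|covered f|.

Definition max_matching_fun (f : {ffun T -> T}) : bool :=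
  matching_fun f && (#|covered f| == max_covered).

Definition match_edges (f : {ffun T -> T}) (A : {set T}) : {set {set T}} :=
  [set [set x; f x] | x in A :&: covered f].

Lemma matching_funK f : matching_fun f -> involutive f.
Proof. by move=> /forallP mf x; case/andP: (mf x) => /eqP. Qed.

Lemma matching_fun_adj f x : matching_fun f -> f x != x -> e x (f x).
Proof. by move=> /forallP mf fx; case/andP: (mf x) => _; rewrite fx. Qed.

Lemma leq_max_covered f : matching_fun f -> #|covered f| <= max_covered.
Proof. by move=> mf; apply: (leq_bigmax_cond (F := fun f => #|covered f|)). Qed.

Lemma max_matching_fun_exists : exists f, max_matching_fun f.
Proof.
have m1 : matching_fun [ffun x => x].
  by apply/forallP => x; rewrite !ffunE !eqxx.
have : 0 < #|[pred f | matching_fun f]| by apply/card_gt0P; exists [ffun x => x].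
case/(eq_bigmax_cond (fun f => #|covered f|)) => f mf cf.
by exists f; rewrite /max_matching_fun /max_covered cf eqxx andbT.
Qed.

Lemma match_edges_partition f (A : {set T}) :
  matching_fun f -> {in A, forall x, f x \in A} ->
  partition (match_edges f A) (A :&: covered f).
Proof.
move=> mf stA; have fK := matching_funK mf.
have inC x : x \in A :&: covered f -> f x \in A :&: covered f.
  by rewrite !inE fK eq_sym => /andP[/stA -> ->].
apply/and3P; split.
- apply/eqP/setP => y; apply/bigcupP/idP => [[B /imsetP[x xC ->]]|yC].
    by rewrite !inE => /orP[] /eqP ->; have := inC x xC; move: xC; rewrite !inE.
  by exists [set y; f y]; [apply/imsetP; exists y | rewrite !inE eqxx].
- apply/trivIsetP => B1 B2 /imsetP[x _ ->] /imsetP[y _ ->].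
  apply: contraNT => /pred0Pn[z] /=.
  have pairE u : z \in [set u; f u] -> [set u; f u] = [set z; f z].
    by rewrite !inE => /orP[] /eqP -> //; rewrite fK setUC.
  by case/andP=> /pairE -> /pairE ->.
- apply/imsetP => -[x _ /setP /(_ x)].
  by rewrite !inE eqxx.
Qed.

Lemma card_covered f (A : {set T}) :
  matching_fun f -> {in A, forall x, f x \in A} ->
  #|A :&: covered f| = #|match_edges f A|.*2.
Proof.
move=> mf stA.
rewrite (@card_uniform_partition _ 2 _ _ _ (match_edges_partition mf stA)) ?muln2 //.
move=> B /imsetP[x]; rewrite !inE => /andP[_ fx] ->.
by rewrite cards2 eq_sym fx.
Qed.

Lemma card_covered_all f : matching_fun f -> #|covered f| = #|match_edges f setT|.*2.
Proof. by move=> mf; rewrite -card_covered // setTI. Qed.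

(** Meant for [x] missed by [f]: the edge [xy] is added and the old partner of [y] is released. If
    [y] is missed too, then [f y = y], the third test never fires, and the matching is augmented. *)
Definition rematch (f : {ffun T -> T}) (x y : T) : {ffun T -> T} :=
  [ffun w => if w == x then y else if w == y then x
             else if w == f y then w else f w].

Hypotheses (e_sym : symmetric e) (e_irr : irreflexive e).

Section Rematch.

Variables (f : {ffun T -> T}) (x y : T).
Hypotheses (mf : matching_fun f) (fx : f x = x) (exy : e x y).

Let fK : involutive f := matching_funK mf.

Let nyx : y != x.
Proof. by apply: contraTneq exy => ->; rewrite e_irr. Qed.

Let nfyx : f y != x.
Proof. by rewrite -fx (inj_eq (can_inj fK)). Qed.

Lemma rematch_matching : matching_fun (rematch f x y).
Proof.
apply/forallP => w; rewrite [rematch _ _ _ w]ffunE.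
have [->|nwx] := eqVneq w x; first by rewrite ffunE (negPf nyx) !eqxx exy implybT.
have [->|nwy] := eqVneq w y; first by rewrite ffunE !eqxx e_sym exy implybT.
have [wfy|nwfy] := eqVneq w (f y).
  by rewrite ffunE (negPf nwx) (negPf nwy) wfy !eqxx.
rewrite ffunE -{1}fx (inj_eq (can_inj fK)) (negPf nwx).
rewrite (can2_eq fK fK) (negPf nwfy) (inj_eq (can_inj fK)) (negPf nwy) fK eqxx /=.
by apply/implyP; exact: matching_fun_adj.
Qed.

Lemma covered_rematch :
  covered (rematch f x y) = x |: (y |: (covered f :\ f y)).
Proof.
apply/setP => w; rewrite !inE ffunE.
have [->|nwx] := eqVneq w x; first by rewrite nyx.
have [->|nwy] := eqVneq w y; first by rewrite eq_sym nyx.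
by have [wfy|nwfy] := eqVneq w (f y); rewrite ?eqxx.
Qed.

Lemma card_covered_rematch : #|covered f| + (f y == y).*2 = #|covered (rematch f x y)|.
Proof.
rewrite covered_rematch.
have cx : x \notin covered f by rewrite inE fx eqxx.
rewrite !cardsU1 (cardsD1 (f y) (covered f)) !in_setU1 !in_setD1 (negPf cx).
rewrite andbF orbF [x == y]eq_sym nyx [y \in _]inE [f y \in _]inE fK.
by rewrite [y == f y]eq_sym; case: (f y == y) => /=; lia.
Qed.

End Rematch.

(** Otherwise [rematch] would cover two more vertices. *)
Lemma max_matching_uncovered_adj f x y :
  max_matching_fun f -> f x = x -> f y = y -> ~~ e x y.
Proof.
case/andP=> mf /eqP cf fx fy; apply/negP => exy.
have := leq_max_covered (rematch_matching mf fx exy).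
rewrite -(card_covered_rematch mf fx exy) fy eqxx; lia.
Qed.

Lemma max_matching_rematch f x y :
  max_matching_fun f -> f x = x -> e x y -> max_matching_fun (rematch f x y).
Proof.
move=> Mf fx exy; have /andP[mf /eqP cf] := Mf.
apply/andP; split; first exact: rematch_matching.
rewrite -(card_covered_rematch mf fx exy) cf.
have [fy|] := eqVneq (f y) y; last by rewrite addn0.
by have := max_matching_uncovered_adj Mf fx fy; rewrite exy.
Qed.

Definition never_both_missed (u v : T) : bool :=
  (u == v) || [forall f, max_matching_fun f ==> ~~ ((f u == u) && (f v == v))].

Lemma never_both_missedP u v :
  reflect (forall f, max_matching_fun f -> f u = u -> f v = v -> u = v)
          (never_both_missed u v).
Proof.
apply: (iffP orP) => [[/eqP //|/forallP h] f Mf /eqP fu /eqP fv|h].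
  by have := h f; rewrite Mf fu fv.
have [->|nuv] := eqVneq u v; [by left | right].
apply/forallP => f; apply/implyP => Mf; apply/negP => /andP[/eqP fu /eqP fv].
by case/eqP: nuv; apply: h Mf fu fv.
Qed.

Lemma never_both_missed_sym u v : never_both_missed u v = never_both_missed v u.
Proof.
by apply/never_both_missedP/never_both_missedP => h f Mf ? ?; apply/esym/(h f).
Qed.

Lemma adj_never_both_missed u v : e u v -> never_both_missed u v.
Proof.
move=> euv; apply/never_both_missedP => f Mf fu fv.
by have := max_matching_uncovered_adj Mf fu fv; rewrite euv.
Qed.

(* Gallai's lemma: given a maximum matching [M] missing [u] and [v], take a
   maximum matching [N] missing [t] that agrees with [M] as much as possible.
   Some [x != t] is missed by [N] but not by [M], and rematching [x] in [N]
   with its [M]-partner increases the agreement. *)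
Lemma never_both_missed_trans t u v :
  (exists2 f, max_matching_fun f & f t = t) ->
  never_both_missed u t -> never_both_missed t v -> never_both_missed u v.
Proof.
case=> N0 MN0 N0t /never_both_missedP ut /never_both_missedP tv.
apply/never_both_missedP => M MM Mu Mv; apply/eqP/negPn/negP => nuv.
have Mt : M t != t.
  apply/eqP => Mt; case/eqP: nuv.
  exact: etrans (ut M MM Mu Mt) (tv M MM Mt Mv).
pose P := [pred g : {ffun T -> T} | max_matching_fun g && (g t == t)].
have PN0 : P N0 by rewrite /= MN0 N0t eqxx.
case: (arg_maxnP (fun g : {ffun T -> T} => #|[set w | M w == g w]|) PN0).
move=> N /andP[MN /eqP Nt] Nmax.
have /andP[mM /eqP cM] := MM; have /andP[mN /eqP cN] := MN.
have Nu : N u != u.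
  by apply: contraNneq Mt => Nu; rewrite -(ut N MN Nu Nt) Mu.
have Nv : N v != v.
  by apply: contraNneq Mt => Nv; rewrite (tv N MN Nt Nv) Mv.
have [x /and3P[nxt /eqP Nx Mx]] : exists x, [&& x != t, N x == x & M x != x].
  apply/existsP; apply: contraT; rewrite negb_exists => /forallP nox.
  (* Without such an [x], [M] would cover fewer vertices than [N]: it gains at most [t] and loses
     both [u] and [v]. *)
  have sub : covered M \subset t |: (covered N :\ u :\ v).
    apply/subsetP => x; rewrite !inE => Mx.
    have [//|nxt /=] := eqVneq x t; have := nox x; rewrite nxt Mx andbT /= => ->.
    by rewrite andbT; apply/andP; split; apply: contraNneq Mx => ->; rewrite ?Mu ?Mv.
  have := subset_leq_card sub.
  have := cardsU1 t (covered N :\ u :\ v); have := cardsD1 u (covered N).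
  have := cardsD1 v (covered N :\ u); rewrite !inE Nu Nv eq_sym nuv /= cM cN.
  by clear; lia.
have exy := matching_fun_adj mM Mx; set y := M x in exy Mx.
have Ny : N y != y.
  by apply/eqP => Ny; have := max_matching_uncovered_adj MN Nx Ny; rewrite exy.
have MK := matching_funK mM; have NK := matching_funK mN.
have /Nmax : P (rematch N x y).
  rewrite /= max_matching_rematch //= ffunE [t == x]eq_sym (negPf nxt).
  have -> : (t == y) = false by apply: contraNF Ny => /eqP <-; rewrite Nt.
  by rewrite Nt; case: ifP.
apply/negP; rewrite -ltnNge; apply: proper_card; apply/properP; split.
  apply/subsetP => w; rewrite !inE ffunE => /eqP MwNw.
  have [->|nwx] := eqVneq w x; first by rewrite eqxx.
  have [->|nwy] := eqVneq w y; first by rewrite MK.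
  (* Agreement could only be lost at [N y], but [M] and [N] agreeing there would force [N y = x]. *)
  have [wNy|nwNy] := eqVneq w (N y); last by rewrite MwNw.
  by case/eqP: nwx; rewrite -[w]MK MwNw wNy NK -[RHS]MK.
by exists x; rewrite !inE ?ffunE ?eqxx // Nx.
Qed.

End InvolutiveMatchings.

(** Turns a strict drop of [max_covered] into a drop by 2. *)
Lemma max_covered_even (T : finType) (e : rel T) : ~~ odd (max_covered e).
Proof.
have [f /andP[mf /eqP <-]] := max_matching_fun_exists e.
by rewrite (card_covered_all mf) odd_double.
Qed.

(** * The degree-sum bound, by deleting vertices covered by every maximum matching *)

Section DegreeSumBound.

Variables (T : finType) (d : nat).
Hypothesis d_gt0 : 0 < d.

Definition trifree_degree_le (e : rel T) : Prop :=
  [/\ symmetric e, irreflexive e,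
      forall x y z, e x y -> e y z -> e x z -> False
    & forall x, deg_in e setT x <= d].

(** The vertex is isolated rather than removed, so the induction stays on one vertex type. *)
Definition delete_vertex (e : rel T) (v : T) : rel T :=
  fun x y => [&& e x y, x != v & y != v].

Lemma delete_vertex_trifree_degree_le e v :
  trifree_degree_le e -> trifree_degree_le (delete_vertex e v).
Proof.
case=> e_sym e_irr e_tf e_deg; split.
- by move=> x y; rewrite /delete_vertex e_sym [(x != v) && _]andbC.
- by move=> x; rewrite /delete_vertex e_irr.
- by move=> x y z /and3P[exy _ _] /and3P[eyz _ _] /and3P[exz _ _]; exact: e_tf exy eyz exz.
- move=> x; apply: leq_trans (e_deg x); apply: leq_sum => y _.
  by rewrite /delete_vertex; case: (e x y) => //; case: (_ && _).
Qed.

Lemma delete_vertex_deg_sum e v : trifree_degree_le e ->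
  \sum_x deg_in e setT x <= \sum_x deg_in (delete_vertex e v) setT x + 2 * d.
Proof.
case=> e_sym _ _ e_deg.
have allE e' x : deg_in e' setT x = \sum_y e' x y.
  by apply: eq_bigl => y; rewrite inE.
have vE : \sum_(x | x != v) e x v <= d.
  apply: leq_trans (e_deg v); rewrite allE [leqRHS](bigD1 v) //=.
  by apply: leq_trans (leq_addl _ _); apply: leq_sum => x _; rewrite e_sym.
rewrite (bigD1 v) //= [X in _ <= X + _](bigD1 v) //=.
have : \sum_(x | x != v) deg_in e setT x <=
    \sum_(x | x != v) deg_in (delete_vertex e v) setT x + \sum_(x | x != v) e x v.
  rewrite -big_split /=; apply: leq_sum => x nxv.
  rewrite !allE (bigD1 v) //= addnC leq_add2r.
  rewrite [leqRHS](bigD1 v) //=; apply: leq_trans (leq_addl _ _).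
  by apply: leq_sum => y nyv; rewrite /delete_vertex nxv nyv !andbT.
have := e_deg v; lia.
Qed.

(** A matching after the deletion is a matching of [e] missing [v], hence not a maximum one. *)
Lemma delete_vertex_max_covered e v :
  (forall f, max_matching_fun e f -> f v != v) ->
  max_covered (delete_vertex e v) + 2 <= max_covered e.
Proof.
move=> v_ess.
have [f /andP[mf /eqP cf]] := max_matching_fun_exists (delete_vertex e v).
have mfe : matching_fun e f.
  apply/forallP => x; rewrite (matching_funK mf) eqxx; apply/implyP => fx.
  by case/and3P: (matching_fun_adj mf fx).
have fv : f v == v.
  by apply/negPn/negP => /(matching_fun_adj mf); rewrite /delete_vertex eqxx andbF.
have := leq_max_covered mfe; rewrite leq_eqVlt => /orP[/eqP cfe|].
  by have := v_ess f; rewrite /max_matching_fun mfe cfe eqxx fv => /(_ isT).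
rewrite cf.
by have := max_covered_even e; have := max_covered_even (delete_vertex e v); lia.
Qed.

(** To be applied to a Gallai class. If [f] covers all of [C], the degree bound suffices; if it
    misses one vertex, [C] has odd size and either Mantel's bound or [sum_deg_in_odd] applies. The
    last term stands for the one extra edge. *)
Lemma closed_set_deg_sum e f (C : {set T}) :
  trifree_degree_le e -> matching_fun e f ->
  {in C, forall x, f x \in C} -> #|C :\: covered f| <= 1 -> #|C :&: covered f| <= 2 * d ->
  \sum_(x in C) deg_in e C x <=
    d * #|C :&: covered f| + 2 * (#|C :&: covered f| == 2 * d).
Proof.
case=> e_sym e_irr e_tf e_deg mf stC.
have degC x : deg_in e C x <= d.
  apply: leq_trans (e_deg x).
  by rewrite (deg_in_setD e x (subsetT C)) leq_addl.
have := cardsID (covered f) C; rewrite (card_covered mf stC).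
set k := #|_|; case: #|C :\: _| => [|[|//]] cC _ le_kd.
  apply: leq_trans (leq_addr _ _).
  rewrite mulnC -[k.*2]addn0 cC -sum_nat_const.
  exact: leq_sum.
have {}cC : #|C| = k.*2.+1 by lia.
have [kd|nkd] := eqVneq k d.
  have := sum_deg_in_odd e_sym e_irr e_tf d_gt0; rewrite -{1}kd => /(_ C cC).
  move/(_ (fun x _ => degC x)); rewrite kd -mul2n eqxx; nia.
have [s le_s] := mantel_bound e_sym e_tf C; rewrite cC => le_sum.
apply: leq_trans le_sum _; apply: leq_trans (leq_addr _ _).
have lt_kd : k < d by lia.
(* Two integers with sum [2k + 1] have the largest product at [k] and [k + 1]; the subtraction
   truncates to 0 for large [s]. *)
have : s * (k.*2.+1 - s) <= k * k.+1.
  have [le_sk|lt_ks] := leqP s k.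
    have [r ->] : exists r, k = s + r by exists (k - s); lia.
    have -> : (s + r).*2.+1 - s = s + r + r + 1 by lia.
    nia.
  have [r ->] : exists r, s = k + r + 1 by exists (s - k - 1); lia.
  have [->|] : k.*2.+1 - (k + r + 1) = 0 \/ k = k.*2.+1 - (k + r + 1) + r by lia.
    by rewrite muln0.
  by set q := _ - _ => ->; nia.
nia.
Qed.

Lemma deg_sum_bound_all_missed e : trifree_degree_le e ->
  (forall v, exists2 f, max_matching_fun e f & f v = v) ->
  max_covered e <= 2 * d ->
  \sum_x deg_in e setT x <= d * max_covered e + 2 * (max_covered e == 2 * d).
Proof.
move=> He missed le_mc; have [e_sym e_irr _ _] := He.
pose R := never_both_missed e.
have Rtrans u t v : R u t -> R t v -> R u v.
  exact: never_both_missed_trans (missed t).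
have Rsym u v : R u v = R v u by exact: never_both_missed_sym.
have eqR : {in [set: T] & &, equivalence_rel R}.
  move=> x y z _ _ _; split; first by rewrite /R /never_both_missed eqxx.
  by move=> Rxy; apply/idP/idP; apply: Rtrans; rewrite // Rsym.
have partP := equivalence_partitionP eqR.
set P := equivalence_partition R setT in partP.
have [f Mf] := max_matching_fun_exists e; have /andP[mf /eqP cf] := Mf.
have PR C x y : C \in P -> x \in C -> (y \in C) = R x y.
  case/imsetP=> z _ ->; rewrite !inE /= => Rzx.
  by apply/idP/idP => [Rzy|]; [apply: Rtrans Rzy; rewrite Rsym | apply: Rtrans].
pose c (C : {set T}) := #|C :&: covered f|.
have sum_c : \sum_(C in P) c C = max_covered e.
  have -> : max_covered e = \sum_(x in [set: T]) if x \in covered f then 1 else 0.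
    by rewrite -cf -sum1_card big_mkcond; apply: eq_bigl => x; rewrite inE.
  rewrite (set_partition_big _ partP); apply: eq_bigr => C _.
  by rewrite -big_mkcondr /c -sum1_card; apply: eq_bigl => x; rewrite inE.
have le_c C : C \in P -> c C <= 2 * d.
  by move=> PC; rewrite (leq_trans _ le_mc) // -sum_c (bigD1 C) //= leq_addr.
have bound C : C \in P ->
    \sum_(x in C) deg_in e setT x <= d * c C + 2 * (c C == 2 * d).
  move=> PC.
  (* Adjacent vertices are related, so no edge leaves a class and degrees can be computed inside
     it. *)
  have closed x y : x \in C -> e x y -> y \in C.
    by move=> xC exy; rewrite (PR C x) //; apply: adj_never_both_missed.
  rewrite (eq_bigr (deg_in e C)); last first.
    move=> x xC; rewrite (deg_in_setD e x (subsetT C)) -[RHS]add0n; congr (_ + _).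
    apply: big1 => y; rewrite !inE andbT => nyC; case exy: (e x y) => //.
    by rewrite (closed x y) in nyC.
  apply: closed_set_deg_sum (mf) _ _ (le_c C PC) => //.
    move=> x xC; have [->//|fx] := eqVneq (f x) x.
    by apply: closed xC _; apply: matching_fun_adj.
  apply/card_le1_eqP => x y; rewrite !inE !negbK => /andP[/eqP fx xC] /andP[/eqP fy yC].
  by have : R x y; [rewrite -(PR C) | move/never_both_missedP/(_ f Mf fx fy)].
have -> : \sum_x deg_in e setT x = \sum_(x in [set: T]) deg_in e setT x.
  by apply: eq_bigl => x; rewrite inE.
rewrite (set_partition_big _ partP).
apply: (@leq_trans (\sum_(C in P) (d * c C + 2 * (c C == 2 * d)))).
  exact: leq_sum.
rewrite big_split /= -!big_distrr /= sum_c leq_add2l leq_mul2l /=.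
(* At most one class can have [2d] covered vertices, and then it accounts for all of
   [max_covered e]. *)
have : 2 * d * \sum_(C in P) (c C == 2 * d) <= max_covered e.
  rewrite -sum_c big_distrr /=; apply: leq_sum => C _.
  by case: eqP => [->|]; rewrite ?muln1 ?muln0.
case: (\sum_(C in P) _) => // k.
case: eqP; nia.
Qed.

(** Induction on [max_covered e]: a deletion costs at most [2d] in the degree sum, paid for by the
    two covered vertices lost, and the smaller graph lies strictly below [2d], where the extra term
    vanishes. *)
Lemma deg_sum_bound e : trifree_degree_le e -> max_covered e <= 2 * d ->
  \sum_x deg_in e setT x <= d * max_covered e + 2 * (max_covered e == 2 * d).
Proof.
have [n] := ubnP (max_covered e); elim: n e => // n IHn e lt_n He le_mc.
have [/forallP missed|] :=
    boolP [forall v, exists f, max_matching_fun e f && (f v == v)].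
  apply: deg_sum_bound_all_missed => // v.
  by case/existsP: (missed v) => f /andP[Mf /eqP fv]; exists f.
case/forallPn=> v; rewrite negb_exists => /forallP v_ess.
have lt_mc : max_covered (delete_vertex e v) + 2 <= max_covered e.
  apply: delete_vertex_max_covered => f Mf.
  by have := v_ess f; rewrite Mf.
have := IHn _ _ (delete_vertex_trifree_degree_le v He).
have -> : (max_covered (delete_vertex e v) == 2 * d) = false by apply/eqP; lia.
move=> IH; have {IH} := IH ltac:(lia) ltac:(lia).
have := delete_vertex_deg_sum v He; nia.
Qed.

End DegreeSumBound.

(** * Transfer to graphs: edge counts, matching numbers and the upper bounds *)

Lemma degreeE (G : sgraph) (x : vertex G) : degree x = deg_in (@adj G) setT x.
Proof. by rewrite deg_in_card; apply: eq_card => y; rewrite !inE. Qed.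

(** Forgetting the order maps adjacent ordered pairs two-to-one onto edges. *)
Lemma handshake (G : sgraph) : \sum_(x : vertex G) degree x = #|edges G|.*2.
Proof.
pose D := [set p : vertex G * vertex G | adj p.1 p.2].
have -> : edges G = [set [set p.1; p.2] | p in D].
  apply/setP => E; rewrite inE; apply/existsP/imsetP.
    by case=> x /existsP[y /andP[xy /eqP ->]]; exists (x, y); rewrite ?inE.
  by case=> -[x y]; rewrite inE => /= xy ->; exists x; apply/existsP; exists y; rewrite xy /=.
have -> : \sum_(x : vertex G) degree x = \sum_(p in D) 1.
  under eq_bigr => x _ do rewrite degreeE /deg_in big_mkcond /=.
  rewrite pair_bigA big_mkcond [RHS]big_mkcond /=; apply: eq_bigr => -[x y] _.
  by rewrite !inE /=; case: adj.
rewrite (partition_big_imset (fun p => [set p.1; p.2])) /= -muln2 -sum_nat_const.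
apply: eq_bigr => E /imsetP[[x y]]; rewrite inE /= => xy ->.
have nxy : x != y by apply: contraTneq xy => ->; rewrite adj_irr.
rewrite sum1dep_card -(_ : #|[set (x, y); (y, x)]| = 2); last first.
  by rewrite cards2 xpair_eqE negb_and nxy.
apply: eq_card => -[u v]; rewrite !inE /= !xpair_eqE.
apply/andP/orP => [[uv /eqP/setP s]|[] /andP[/eqP-> /eqP->]]; last 2 first.
- by rewrite xy eqxx.
- by rewrite adj_sym xy setUC eqxx.
have nuv : u != v by apply: contraTneq uv => ->; rewrite adj_irr.
have := s u; have := s v; have := s x; rewrite !inE !eqxx !orbT /=.
case: (eqVneq u x) => [ux|_] /=; case: (eqVneq u y) => [uy|_] //=.
- by rewrite -ux uy eqxx in nxy.
- case: (eqVneq v y) => [vy|_]; first by left.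
  by rewrite orbF => _ /esym/eqP vx; rewrite ux vx eqxx in nuv.
- case: (eqVneq v x) => [vx|_]; first by right.
  by move=> _ /esym/= /eqP vy; rewrite uy vy eqxx in nuv.
Qed.

Lemma card_cover_matching (G : sgraph) (M : {set {set vertex G}}) :
  is_matching M -> #|cover M| = #|M|.*2.
Proof.
case/andP=> /subsetP sM triM.
have M2 E : E \in M -> #|E| = 2.
  move/sM; rewrite inE => /existsP[x /existsP[y /andP[xy /eqP ->]]].
  by rewrite cards2 (_ : x != y) //; apply: contraTneq xy => ->; rewrite adj_irr.
rewrite (@card_uniform_partition _ 2 M (cover M)) ?muln2 //.
rewrite /partition eqxx triM /=; apply/negP => /M2.
by rewrite cards0.
Qed.

Lemma matching_number_le_half (G : sgraph) (m : nat) :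
  #|vertex G| <= m.*2.+1 -> matching_number G <= m.
Proof.
move=> le_V; apply/bigmax_leqP => M /card_cover_matching cM.
by have := max_card (mem (cover M)); rewrite cM; lia.
Qed.

Lemma max_covered_le (G : sgraph) : max_covered (@adj G) <= 2 * matching_number G.
Proof.
apply/bigmax_leqP => f mf; rewrite (card_covered_all mf) -mul2n leq_mul2l /=.
apply: (leq_bigmax_cond (F := fun M : {set {set vertex G}} => #|M|)).
have /and3P[_ triM _] := match_edges_partition (A := setT) mf (fun x _ => in_setT (f x)).
rewrite /is_matching triM andbT; apply/subsetP => E /imsetP[x].
rewrite !inE => /andP[_ fx] ->; apply/existsP; exists x; apply/existsP; exists (f x).
by rewrite matching_fun_adj //=.
Qed.

Lemma degree_le_max (G : sgraph) (x : vertex G) : degree x <= max_degree G.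
Proof. exact: (leq_bigmax x). Qed.

Lemma admissible_edges_le (d : nat) (G : sgraph) :
  0 < d -> admissible d d G -> #|edges G| <= d ^ 2 + 1.
Proof.
move=> d_gt0 [tf le_deg le_nu].
have He : trifree_degree_le d (@adj G).
  split; [exact: adj_sym | exact: adj_irr | |].
    by move=> x y z xy yz xz; apply: (tf x y z).
  by move=> x; rewrite -degreeE (leq_trans (degree_le_max x)).
have le_mc : max_covered (@adj G) <= 2 * d.
  by apply: leq_trans (max_covered_le G) _; rewrite leq_mul2l.
have := deg_sum_bound d_gt0 He le_mc.
rewrite -(eq_bigr _ (fun x _ => degreeE x)) handshake.
have := leq_b1 (max_covered (@adj G) == 2 * d); nia.
Qed.

(** Either end of an edge determines the other, so edges that meet coincide. *)
Lemma degree_le1_edges_matching (G : sgraph) :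
  max_degree G <= 1 -> is_matching (edges G).
Proof.
move=> le_deg; rewrite /is_matching subxx /=.
have pairE E x y : E \in edges G -> x \in E -> adj x y -> E = [set x; y].
  rewrite inE => /existsP[u /existsP[v /andP[uv /eqP ->]]].
  have nbr z w w' : adj z w -> adj z w' -> w = w' :> vertex G.
    move=> zw zw'; have /card_le1_eqP := leq_trans (degree_le_max z) le_deg.
    by apply; rewrite inE.
  rewrite !inE => /orP[] /eqP -> xy; first by rewrite (nbr _ _ _ uv xy).
  by rewrite adj_sym in uv; rewrite (nbr _ _ _ uv xy) setUC.
apply/trivIsetP => E F EG FG; apply: contraNT => /pred0Pn[x /andP[/= xE xF]].
have [y xy] : exists y, adj x y.
  move: (EG) xE; rewrite inE => /existsP[u /existsP[v /andP[uv /eqP ->]]].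
  by rewrite !inE => /orP[] /eqP ->; [exists v | exists u; rewrite adj_sym].
by rewrite (pairE E x y) // (pairE F x y).
Qed.

Lemma admissible_edges_le1 (G : sgraph) : admissible 1 1 G -> #|edges G| <= 1.
Proof.
case=> _ /degree_le1_edges_matching mE; apply: leq_trans.
exact: (leq_bigmax_cond (F := fun M : {set {set vertex G}} => #|M|)).
Qed.

(** * Extremal graphs *)

Section SubdividedBiclique.

Variable n : nat.

Definition sb_vertex : finType := ('I_n.+1 + 'I_n.+1 + unit)%type.

(* The complete bipartite graph on [n.+1 + n.+1] vertices in which the edge
   joining the two vertices [ord0] is subdivided by [inr tt]. *)
Definition sb_adj (x y : sb_vertex) : bool :=
  match x, y with
  | inl (inl i), inl (inr j) | inl (inr i), inl (inl j) =>
      (i != ord0) || (j != ord0)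
  | inl (inl i), inr _ | inl (inr i), inr _
  | inr _, inl (inl i) | inr _, inl (inr i) => i == ord0
  | _, _ => false
  end.

Lemma sb_adj_sym : symmetric sb_adj.
Proof. by move=> [[i|i]|[]] [[j|j]|[]] //=; rewrite orbC. Qed.

Lemma sb_adj_irr : irreflexive sb_adj.
Proof. by move=> [[i|i]|[]]. Qed.

Definition subdivided_biclique : sgraph := SGraph sb_adj_sym sb_adj_irr.

Lemma sb_triangle_free : triangle_free subdivided_biclique.
Proof.
case=> [[i|i]|[]] [[j|j]|[]] [[k|k]|[]] [] //=.
all: by do 2![case: (_ =P ord0) => //= _].
Qed.

Lemma sb_degree (x : vertex subdivided_biclique) :
  degree x = if x is inr _ then 2 else n.+1.
Proof.
have sum0 : \sum_(j < n.+1) (j == ord0) = 1.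
  by rewrite (bigD1 ord0) //= big1 // => j /negPf ->.
(* The vertex [ord0] of a side trades its opposite [ord0] for the subdividing vertex, so its degree
   remains [n.+1]. *)
have sumI (i : 'I_n.+1) :
    \sum_(j < n.+1) ((i != ord0) || (j != ord0)) + (i == ord0) = n.+1.
  case: (i == ord0) => /=; last first.
    by rewrite addn0 sum1_card card_ord.
  rewrite -sum0 -big_split /= -[RHS]card_ord -sum1_card.
  by apply: eq_bigr => j _; case: eqP.
rewrite degreeE /deg_in; under eq_bigl => y do rewrite inE.
rewrite !big_sumType /= (big_pred1 tt) //=.
by case: x => [[i|i]|[]] /=; rewrite ?big1_eq ?add0n ?addn0 ?sumI ?sum0.
Qed.

End SubdividedBiclique.

Lemma sb_admissible (n : nat) : 0 < n -> admissible n.+1 n.+1 (subdivided_biclique n).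
Proof.
move=> n_gt0; split; first exact: sb_triangle_free.
  (* The subdividing vertex has degree 2, within the bound since [0 < n]. *)
  by apply/bigmax_leqP => x _; rewrite sb_degree; case: x => [[]|].
by apply: matching_number_le_half; rewrite /= !card_sum !card_ord card_unit; lia.
Qed.

Lemma sb_card_edges (n : nat) : #|edges (subdivided_biclique n)| = n.+1 ^ 2 + 1.
Proof.
apply: double_inj; rewrite -handshake; under eq_bigr => x _ do rewrite sb_degree.
rewrite !big_sumType /= !sum_nat_const !card_ord card_unit; nia.
Qed.

Definition single_edge : sgraph :=
  @SGraph bool (fun x y => x != y) (fun x y => congr1 negb (eq_sym x y))
    (fun x => congr1 negb (eqxx x)).

Lemma single_edge_degree (x : vertex single_edge) : degree x = 1.
Proof.
rewrite degreeE /deg_in; under eq_bigl => y do rewrite inE.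
by rewrite big_bool; case: x.
Qed.

Lemma single_edge_admissible : admissible 1 1 single_edge.
Proof.
split; first by move=> [] [] [] [].
  by apply/bigmax_leqP => x _; rewrite single_edge_degree.
by apply: matching_number_le_half; rewrite /= card_bool.
Qed.

Lemma single_edge_card_edges : #|edges single_edge| = 1.
Proof.
apply: double_inj; rewrite -handshake.
by under eq_bigr => x _ do rewrite single_edge_degree; rewrite sum_nat_const card_bool.
Qed.

Theorem theorem3 :
  f_triangle_eq 1 1 1 /\
  (forall d : nat, 2 <= d -> f_triangle_eq d d (d ^ 2 + 1)).
Proof.
split.
  split; last exact: admissible_edges_le1.
  by exists single_edge; [exact: single_edge_admissible | exact: single_edge_card_edges].
case=> [//|n] n_gt0; split; last by move=> G; apply: admissible_edges_le.
by exists (subdivided_biclique n); [exact: sb_admissible | exact: sb_card_edges].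
Qed.
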